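(* Let $T>0$, $I=[0,T]$, let $\kappa\in\mathscr{K}_{\mathrm{reg}}$ be a regular admissible kernel, let $\Lambda\in\mathscr{A}(I)$ be an adaptive sensitivity function, and let $f\in\mathcal{C}(I)$. The functional $S_{\kappa,\Lambda}(f)=\sup_{t\in I}\mathcal{M}_f(t)$ satisfies: (i) $S_{\kappa,\Lambda}(f)$ exists as a real number and is uniquely determined. (ii) With $\Lambda_\infty:=\sup_{(s,x)\in I\times\mathbb{R}}\Lambda(s,x)$ and $\kappa_\infty:=\sup_{\tau\in I}\kappa(\tau)$ (both finite), $$S_{\kappa,\Lambda}(f)\le\bigl(1+\Lambda_\infty\kappa_\infty T\bigr)\|f\|_\infty.$$ (iii) $S_{\kappa,\Lambda}(f)\ge 0$, and $S_{\kappa,\Lambda}(f)=0$ if and only if $f\equiv 0$ on $I$. (iv) $\|f\|_\infty\le S_{\kappa,\Lambda}(f)$.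
   Context: Fix $T>0$ and $I=[0,T]$. $\mathcal{C}(I)$ is the set of continuous functions $I\to\mathbb{R}$ and $\|f\|_\infty:=\sup_{t\in I}|f(t)|$. Regular admissible kernels: $\mathscr{K}_{\mathrm{reg}}$ is the set of Lebesgue measurable, integrable functions $\kappa:I\to[0,\infty)$ such that (uniform boundedness) there are constants $0<m_\kappa\le M_\kappa<\infty$ with $m_\kappa\le\kappa(\tau)\le M_\kappa$ for all $\tau\in I$; (normalization) $\int_0^T\kappa(\tau)\,d\tau=1$; (Lipschitz continuity) there is $L_\kappa>0$ with $|\kappa(\tau_1)-\kappa(\tau_2)|\le L_\kappa|\tau_1-\tau_2|$ for all $\tau_1,\tau_2\in I$. Adaptive sensitivity functions: $\mathscr{A}(I)$ is the set of functions $\Lambda:I\times\mathbb{R}\to[0,\infty)$ such that: there are constants $0<\lambda_{\min}\le\lambda_{\max}<\infty$ with $\lambda_{\min}\le\Lambda(s,x)\le\lambda_{\max}$ for all $(s,x)\in I\times\mathbb{R}$; there is $L_\Lambda>0$ with $|\Lambda(s,x)-\Lambda(s,y)|\le L_\Lambda|x-y|$ for all $s\in I$, $x,y\in\mathbb{R}$; for every fixed $x\in\mathbb{R}$, $s\mapsto\Lambda(s,x)$ is Lebesgue measurable on $I$; there is $\varrho>0$ with $\Lambda(s,0)\ge\varrho$ for all $s\in I$. For $f\in\mathcal{C}(I)$ and $t\in I$ define $$\mathcal{J}_f(t):=\int_0^t\Lambda(s,f(s))\,\kappa(t-s)\,|f(s)|\,ds,\qquad \mathcal{M}_f(t):=|f(t)|+\mathcal{J}_f(t),$$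 and the adaptive memory-dependent functional $S_{\kappa,\Lambda}(f):=\sup_{t\in I}\mathcal{M}_f(t)$. *)

(* Defs.v *)
From mathcomp Require Import all_boot all_order all_algebra.
From mathcomp Require Import all_classical all_reals all_analysis.

Set Implicit Arguments.
Unset Strict Implicit.
Unset Printing Implicit Defensive.

Import Order.TTheory GRing.Theory Num.Theory.
Import numFieldNormedType.Exports.

Local Open Scope classical_set_scope.
Local Open Scope ring_scope.

(* Functions on I = [0, T] are represented by total functions on R, of which
   only the values on [0, T] are constrained and used. *)

(* "Lebesgue measurable" is taken literally: measurable for the Caratheodory
   (completed) sigma-algebra, not just Borel measurable. [leb_line R] is R
   equipped with that sigma-algebra, [leb] the Lebesgue measure on it; values
   of functions keep the Borel sigma-algebra. *)
Definition leb_line (R : realType) :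
    measurableType (caratheodory_display (mu_ext (@wlength R idfun))) :=
  caratheodory_type (mu_ext (@wlength R idfun)).

Definition leb (R : realType) : {measure set (leb_line R) -> \bar R} :=
  @completed_lebesgue_measure R.

Record regular_kernel (R : realType) (T : R) (kappa : R -> R) : Prop :=
  RegularKernel {
    rk_ge0 : forall tau, tau \in `[0, T] -> 0 <= kappa tau ;
    rk_measurable : measurable_fun (`[0, T] : set (leb_line R)) kappa ;
    rk_integrable :
      (leb R).-integrable `[0, T] (fun tau => (kappa tau)%:E) ;
    rk_bounded : exists m M : R, [/\ 0 < m, m <= M &
      forall tau, tau \in `[0, T] -> m <= kappa tau <= M] ;
    rk_normalized : (\int[leb R]_(tau in `[0%R, T]) (kappa tau)%:E = 1)%E ;
    rk_lipschitz : exists2 L : R, 0 < L & L.-lipschitz_`[0, T] kappa }.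

Record adaptive_sensitivity (R : realType) (T : R) (Lambda : R -> R -> R) :
    Prop := AdaptiveSensitivity {
  as_ge0 : forall s x, s \in `[0, T] -> 0 <= Lambda s x ;
  as_bounded : exists lmin lmax : R, [/\ 0 < lmin, lmin <= lmax &
    forall s x, s \in `[0, T] -> lmin <= Lambda s x <= lmax] ;
  as_lipschitz : exists2 L : R, 0 < L &
    forall s, s \in `[0, T] -> L.-lipschitz (Lambda s) ;
  as_measurable : forall x,
    measurable_fun (`[0, T] : set (leb_line R)) (fun s => Lambda s x) ;
  as_nondegenerate : exists2 rho : R, 0 < rho &
    forall s, s \in `[0, T] -> rho <= Lambda s 0 }.

Section functional.
Context {R : realType}.
Implicit Types (T t s : R) (kappa f : R -> R) (Lambda : R -> R -> R).

Definition sup_norm T f : R := sup [set `|f t| | t in `[0, T]].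

Definition kernel_sup T kappa : R := sup [set kappa tau | tau in `[0, T]].

Definition sensitivity_sup T Lambda : R :=
  sup [set Lambda p.1 p.2 | p in `[0, T] `*` [set: R]].

Definition memory_integrand kappa Lambda f t s : R :=
  Lambda s (f s) * kappa (t - s) * `|f s|.

Definition memory kappa Lambda f t : R :=
  \int[leb R]_(s in `[0, t]) memory_integrand kappa Lambda f t s.

Definition memory_functional kappa Lambda f t : R :=
  `|f t| + memory kappa Lambda f t.

Definition memory_values T kappa Lambda f : set R :=
  [set memory_functional kappa Lambda f t | t in `[0, T]].

Definition adaptive_functional T kappa Lambda f : R :=
  sup (memory_values T kappa Lambda f).

End functional.

(* Main.v *)
Require Import Defs.

From mathcomp Require Import all_boot all_order all_algebra.
From mathcomp Require Import all_classical all_reals all_analysis.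
From mathcomp Require Import measurable_realfun ring lra.

Set Implicit Arguments.
Unset Strict Implicit.
Unset Printing Implicit Defensive.

Import Order.TTheory GRing.Theory Num.Theory.
Import numFieldNormedType.Exports.

Local Open Scope classical_set_scope.
Local Open Scope ring_scope.

(** The functional is well behaved because its memory integrand
    [Lambda s (f s) * kappa (t - s) * `|f s|] is measurable and lies between 0
    and the constant [Lambda_oo * kappa_oo * sup_norm f] on [[0, t]].  Once this
    is known, everything is order theory: the memory term is nonnegative and at
    most [Lambda_oo * kappa_oo * T * sup_norm f], so that pointwise

      [`|f t| <= memory_functional t
               <= (1 + Lambda_oo * kappa_oo * T) * sup_norm f],

    and taking suprema gives existence, the upper bound and the domination of
    the sup norm.  Domination of [`|f t|] also forces [f] to vanish when the
    functional does; conversely, for [f = 0] all the values whose supremum is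
    taken are 0.

    The analytic content is the measurability of [s |-> Lambda s (f s)], since
    [Lambda] is only separately regular: measurable in time, Lipschitz in space.
    [measurable_fun_lipschitz_comp] obtains it by writing a function that is
    [L]-Lipschitz in its second variable as the countable infimum
    [F s x = inf_q (F s q + L * `|x - q|)] over rational [q].  The kernel
    factor is measurable because it is Lipschitz, hence continuous, and
    reflection in [t / 2] maps [[0, t]] into itself.  Borel facts are moved to
    the Lebesgue sigma-algebra through [sub_caratheodory]; on Borel sets the two
    measures are the same outer measure. *)

(** * Borel sets and functions on the Lebesgue line *)

Lemma borel_leb_measurable (R : realType) (A : set R) :
  measurable A -> measurable (A : set (leb_line R)).
Proof. exact: sub_caratheodory. Qed.

Lemma leb_measurable_itv (R : realType) (i : interval R) :
  measurable ([set` i] : set (leb_line R)).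
Proof. by apply: borel_leb_measurable; exact: measurable_itv. Qed.

Lemma borel_leb_measurable_fun (R : realType) (D : set R) (f : R -> R) :
  measurable D -> measurable_fun D f ->
  measurable_fun (D : set (leb_line R)) f.
Proof. by move=> mD mf _ B mB; apply: borel_leb_measurable; exact: mf. Qed.

(** The completed measure and the Borel one are the same outer measure,
    restricted to different sigma-algebras, so their values agree by
    conversion. *)
Lemma leb_itvcc0 (R : realType) (t : R) :
  0 <= t -> leb R `[0, t]%classic = t%:E.
Proof.
move=> t0; rewrite [LHS](lebesgue_measure_itv `[0, t])/= lte_fin sube0.
by case: ltgtP t0 => // <-.
Qed.

(** * Measurability of Caratheodory compositions *)

Lemma lipschitz_within_continuous (R : realType) (A : set R) (L : R)
    (f : R -> R) :
  0 < L -> L.-lipschitz_A f -> {within A, continuous f}.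
Proof.
move=> L0 lip; apply/subspace_continuousP => x Ax.
apply/cvgrPdist_lt => e e0; near=> y.
have Ay : A y by near: y; exact: withinT.
apply: le_lt_trans (lip (x, y) (conj Ax Ay)) _; rewrite /= mulrC -ltr_pdivlMr//.
near: y; rewrite near_withinE; near=> z => _.
near: z; apply: (@cvgr_dist_lt _ _ _ _ _ id) => //; exact: divr_gt0.
Unshelve. all: by end_near. Qed.

(** Since [F s x <= F s q + L * `|x - q|] with near equality for [q] close to
    [x], one has [F s (g s) < a] exactly when [F s q + L * `|g s - q| < a] for
    some rational [q].  For each [q] the latter condition defines a measurable
    set, because [F ^~ q] and [g] are measurable. *)
Lemma measurable_fun_lipschitz_comp (R : realType) (d : measure_display)
    (X : measurableType d) (D : set X) (L : R) (F : X -> R -> R) (g : X -> R) :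
  0 < L -> (forall s, D s -> L.-lipschitz (F s)) ->
  (forall x, measurable_fun D (F ^~ x)) -> measurable_fun D g ->
  measurable_fun D (fun s => F s (g s)).
Proof.
move=> L0 lip mF mg mD.
apply: (measurability _ (RGenInftyO.measurableE R)) => // _ [_ [a ->] <-].
have lipE s x y : D s -> F s x <= F s y + L * `|x - y|.
  move=> Ds; rewrite -lerBlDl; apply: le_trans (ler_norm _) _.
  exact: lip Ds (x, y) (conj I I).
suff -> : D `&` (fun s => F s (g s)) @^-1` `]-oo, a[ =
    \bigcup_(q : rat) (D `&` (fun s => F s (ratr q) + L * `|g s - ratr q|)
      @^-1` `]-oo, a[).
  apply: bigcupT_measurable_rat => q.
  have mq : measurable_fun D (fun s => F s (ratr q) + L * `|g s - ratr q|).
    apply: measurable_funD => //; apply: measurable_funM => //.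
    by apply: measurableT_comp => //; exact: measurable_funB.
  exact: mq.
apply/seteqP; split=> [s [Ds]|s [q _ [Ds]]]; rewrite /= !in_itv/= => Fa.
  (* going from [g s] to [q] costs [L * r] twice: once in the Lipschitz bound
     for [F s q] and once in the added term, which exhausts [a - F s (g s)] *)
  set r := (a - F s (g s)) / (2 * L).
  have r0 : 0 < r by rewrite divr_gt0 ?subr_gt0 ?mulr_gt0.
  have [q] : exists q, ratr q \in `]g s - r, g s + r[.
    by apply: rat_in_itvoo; lra.
  rewrite in_itv/= => gq; exists q => //; split=> //=; rewrite in_itv/=.
  have gqr : L * `|g s - ratr q| < (a - F s (g s)) / 2.
    have -> : (a - F s (g s)) / 2 = L * r by rewrite /r; field; lra.
    by rewrite ltr_pM2l// ltr_distlC.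
  have := lipE s (ratr q) (g s) Ds; rewrite distrC; lra.
by split=> //; exact: le_lt_trans (lipE _ _ _ Ds) Fa.
Qed.

(** * Bounds on the memory term *)

Lemma has_sup_image (R : realType) (X : Type) (A : set X) (h : X -> R) (M : R) :
  A !=set0 -> (forall x, A x -> h x <= M) -> has_sup (h @` A).
Proof.
by move=> [x Ax] hM; split; [exists (h x), x | exists M => _ [y Ay <-]; exact: hM].
Qed.

Lemma has_sup_norm (R : realType) (T : R) (f : R -> R) :
  0 < T -> {within `[0, T], continuous f} ->
  has_sup [set `|f t| | t in `[0, T]].
Proof.
move=> T0 cf.
have /(EVT_max (ltW T0))[c _ fc] : {within `[0, T], continuous (fun t => `|f t|)}.
  by move=> x; apply: cvg_norm; exact: cf.
apply: (@has_sup_image _ _ _ _ `|f c|) => //.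
by exists 0; rewrite /= in_itv/= lexx ltW.
Qed.

Section memory.
Context {R : realType} (T : R) (kappa : R -> R) (Lambda : R -> R -> R)
  (f : R -> R).
Context (T_gt0 : 0 < T) (kappa_reg : regular_kernel T kappa)
  (Lambda_adm : adaptive_sensitivity T Lambda)
  (f_cont : {within `[0, T], continuous f}).

Local Notation bound :=
  (sensitivity_sup T Lambda * kernel_sup T kappa * sup_norm T f).

Lemma has_sup_kernel : has_sup [set kappa tau | tau in `[0, T]].
Proof.
have [m [M [_ _ kM]]] := rk_bounded kappa_reg.
apply: (@has_sup_image _ _ _ _ M) => [|x /kM /andP[]//].
by exists 0; rewrite /= in_itv/= lexx ltW.
Qed.

Lemma has_sup_sensitivity :
  has_sup [set Lambda p.1 p.2 | p in `[0, T] `*` [set: R]].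
Proof.
have [m [M [_ _ LM]]] := as_bounded Lambda_adm.
apply: (@has_sup_image _ _ _ _ M) => [|[s x] [/= /LM] /(_ x) /andP[]//].
by exists (0, 0); split => //=; rewrite in_itv/= lexx ltW.
Qed.

Lemma sup_norm_ge t : t \in `[0, T] -> `|f t| <= sup_norm T f.
Proof.
by move=> tT; apply: (sup_upper_bound (has_sup_norm T_gt0 f_cont)); exists t.
Qed.

Lemma kernel_sup_ge t : t \in `[0, T] -> kappa t <= kernel_sup T kappa.
Proof. by move=> tT; apply: (sup_upper_bound has_sup_kernel); exists t. Qed.

Lemma sensitivity_sup_ge s x :
  s \in `[0, T] -> Lambda s x <= sensitivity_sup T Lambda.
Proof.
by move=> sT; apply: (sup_upper_bound has_sup_sensitivity); exists (s, x).
Qed.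

Lemma memory_integrand_bounds t s :
  t \in `[0, T] -> s \in `[0, t] ->
  0 <= memory_integrand kappa Lambda f t s <= bound.
Proof.
rewrite !in_itv/= => /andP[t0 tT] /andP[s0 st].
have sT : s \in `[0, T] by rewrite in_itv/= s0 (le_trans st).
have tsT : t - s \in `[0, T] by rewrite in_itv/=; lra.
have L0 := as_ge0 Lambda_adm (f s) sT; have k0 := rk_ge0 kappa_reg tsT.
rewrite /memory_integrand !mulr_ge0//= !ler_pM ?mulr_ge0 ?sup_norm_ge//.
- exact: sensitivity_sup_ge.
- exact: kernel_sup_ge.
Qed.

Lemma measurable_memory_integrand t : t \in `[0, T] ->
  measurable_fun (`[0, t]%classic : set (leb_line R))
    (memory_integrand kappa Lambda f t).
Proof.
move=> tT; have [t0 tT'] : 0 <= t /\ t <= T.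
  by move: tT; rewrite in_itv/= => /andP.
have sub : `[0, t] `<=` `[0, T] by apply: subset_itvl; rewrite bnd_simp.
have m_itv : measurable (`[0, t]%classic : set (leb_line R)).
  exact: leb_measurable_itv.
have mf : measurable_fun (`[0, t]%classic : set (leb_line R)) f.
  apply: borel_leb_measurable_fun => //.
  apply: subspace_continuous_measurable_fun => //.
  exact: continuous_subspaceW f_cont.
apply: measurable_funM; last exact: measurableT_comp.
apply: measurable_funM.
  have [L L0 lip] := as_lipschitz Lambda_adm.
  apply: (measurable_fun_lipschitz_comp L0) => // [s /sub|x].
    exact: lip.
  apply: measurable_funS (as_measurable Lambda_adm x) => //.
  exact: leb_measurable_itv.
apply: borel_leb_measurable_fun => //.
apply: subspace_continuous_measurable_fun => //.
have [L L0 lip] := rk_lipschitz kappa_reg.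
(* [s |-> kappa (t - s)] inherits the constant of [kappa] *)
apply: (lipschitz_within_continuous L0) => -[x y]/= [].
rewrite !in_itv/= => /andP[x0 xt] /andP[y0 yt].
have := lip (t - x, t - y); rewrite /= !in_itv/=.
have -> : t - x - (t - y) = - (x - y) by ring.
by rewrite normrN; apply; split; lra.
Qed.

Lemma integrable_memory_integrand t : t \in `[0, T] ->
  (leb R).-integrable `[0, t]
    (fun s => (memory_integrand kappa Lambda f t s)%:E).
Proof.
move=> tT; have t0 : 0 <= t by move: tT; rewrite in_itv/= => /andP[].
apply: measurable_bounded_integrable.
- exact: leb_measurable_itv.
- by rewrite /= leb_itvcc0// ltry.
- exact: measurable_memory_integrand.
exists bound; split; first exact: num_real.
move=> M bM s /= st; have /andP[m0 mb] := memory_integrand_bounds tT st.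
by rewrite ger0_norm// (le_trans mb)// ltW.
Qed.

Lemma memory_ge0 t : t \in `[0, T] -> 0 <= memory kappa Lambda f t.
Proof.
by move=> tT; apply: Rintegral_ge0 => s /(memory_integrand_bounds tT)/andP[].
Qed.

Lemma memory_le t : t \in `[0, T] -> memory kappa Lambda f t <= bound * T.
Proof.
move=> tT; have [t0 tT'] : 0 <= t /\ t <= T.
  by move: tT; rewrite in_itv/= => /andP.
have m_itv : measurable (`[0, t]%classic : set (leb_line R)).
  exact: leb_measurable_itv.
(* the integrand at [s = 0] lies between 0 and the bound *)
have b0 : 0 <= bound.
  have zI : 0 \in `[0, t] by rewrite in_itv/= lexx.
  by have /andP[] := memory_integrand_bounds tT zI; exact: le_trans.
apply: (@le_trans _ _ (bound * t)); last exact: ler_wpM2l.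
have -> : bound * t = \int[leb R]_(s in `[0, t]) bound.
  by rewrite Rintegral_cst// leb_itvcc0.
apply: le_Rintegral => //.
- exact: integrable_memory_integrand.
- apply: measurable_bounded_integrable => //.
    by rewrite /= leb_itvcc0// ltry.
  exact: bounded_cst.
- by move=> s /(memory_integrand_bounds tT)/andP[].
Qed.

(** This bound, uniform in [t], is both what makes the supremum finite and its
    upper estimate. *)
Lemma memory_functional_le t : t \in `[0, T] ->
  memory_functional kappa Lambda f t <=
  (1 + sensitivity_sup T Lambda * kernel_sup T kappa * T) * sup_norm T f.
Proof.
move=> tT; have := memory_le tT; have := sup_norm_ge tT.
rewrite /memory_functional; lra.
Qed.

Lemma has_sup_memory_values : has_sup (memory_values T kappa Lambda f).
Proof.
apply: has_sup_image memory_functional_le.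
by exists 0; rewrite /= in_itv/= lexx ltW.
Qed.

Lemma norm_le_adaptive_functional t : t \in `[0, T] ->
  `|f t| <= adaptive_functional T kappa Lambda f.
Proof.
move=> tT; apply: (@le_trans _ _ (memory_functional kappa Lambda f t)).
  by rewrite lerDl memory_ge0.
by apply: (sup_upper_bound has_sup_memory_values); exists t.
Qed.

End memory.

(** * The functional *)

Lemma adaptive_functional_eq0 (R : realType) (T : R) (kappa : R -> R)
    (Lambda : R -> R -> R) (f : R -> R) :
  0 < T -> (forall t, t \in `[0, T] -> f t = 0) ->
  adaptive_functional T kappa Lambda f = 0.
Proof.
move=> T0 f0; rewrite /adaptive_functional.
suff -> : memory_values T kappa Lambda f = [set 0] by exact: sup1.
have M0 t : t \in `[0, T] -> memory_functional kappa Lambda f t = 0.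
  move=> tT; rewrite /memory_functional f0// normr0 add0r /memory.
  rewrite (@eq_Rintegral _ _ _ _ _ (cst 0)) ?Rintegral_cst ?mul0r//.
    exact: leb_measurable_itv.
  move=> s; rewrite inE/= => st; rewrite /memory_integrand f0 ?normr0 ?mulr0//.
  by move: st tT; rewrite !in_itv/= => /andP[-> st] /andP[_]; exact: le_trans.
apply/seteqP; split=> [_ [t tT <-]|_ ->] /=; first exact: M0.
have zT : 0 \in `[0, T] by rewrite in_itv/= lexx ltW.
by exists 0; last exact: M0.
Qed.

Theorem lemma4p2 (R : realType) (T : R) (kappa : R -> R)
    (Lambda : R -> R -> R) (f : R -> R) (T_gt0 : 0 < T)
    (kappa_reg : regular_kernel T kappa)
    (Lambda_adm : adaptive_sensitivity T Lambda)
    (f_cont : {within `[0, T], continuous f}) :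
  let S := adaptive_functional T kappa Lambda f in
  [/\ (* (i) *)
      [/\ forall t, t \in `[0, T] -> (leb R).-integrable `[0, t]
            (fun s => (memory_integrand kappa Lambda f t s)%:E),
          supremums (memory_values T kappa Lambda f) S &
          forall r, supremums (memory_values T kappa Lambda f) r -> r = S],
      (* (ii) *)
      [/\ has_sup [set Lambda p.1 p.2 | p in `[0, T] `*` [set: R]],
          has_sup [set kappa tau | tau in `[0, T]] &
          S <= (1 + sensitivity_sup T Lambda * kernel_sup T kappa * T)
               * sup_norm T f],
      (* (iii) *)
      0 <= S /\ (S = 0 <-> forall t, t \in `[0, T] -> f t = 0) &
      (* (iv) *)
      sup_norm T f <= S].
Proof.
move=> S.
have zT : `[0, T]%classic (0 : R) by rewrite /= in_itv/= lexx ltW.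
have hasM := has_sup_memory_values T_gt0 kappa_reg Lambda_adm f_cont.
have fS := norm_le_adaptive_functional T_gt0 kappa_reg Lambda_adm f_cont.
have supS : supremums (memory_values T kappa Lambda f) S.
  split; first exact: sup_upper_bound.
  by move=> r rub; apply: ge_sup => //; case: hasM.
split.
- split=> // [t|r rS]; first exact: integrable_memory_integrand.
  exact: is_subset1_supremums rS supS.
- split; first exact: has_sup_sensitivity.
    exact: has_sup_kernel.
  apply: ge_sup => [|_ [t tT <-]]; first by case: hasM.
  exact: memory_functional_le.
- split; first exact: le_trans (normr_ge0 (f 0)) (fS _ zT).
  split=> [S0 t tT|]; last exact: adaptive_functional_eq0.
  by apply/eqP; rewrite -normr_le0 -S0; exact: fS.
- by apply: ge_sup => [|_ [t tT <-]]; [exists `|f 0|, 0 | exact: fS].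
Qed.
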